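(* Let $Z$ be a finite set, let $P$ be a row-stochastic Markov kernel on $Z$, let $f:Z\to X$ be a map to a finite set $X$ with fibers $B_x:=f^{-1}(x)$, let $\tau\ge 1$ be an integer, and let $(u_x)_{x\in X}$ be probability distributions on $Z$ with $\mathrm{supp}(u_x)\subseteq B_x$. Define $Q_f:\Delta(Z)\to\Delta(X)$ by $(Q_f\mu)(x)=\sum_{z\in B_x}\mu(z)$, $U_f:\Delta(X)\to\Delta(Z)$ by $(U_f\nu)(z)=\sum_{x\in X}\nu(x)u_x(z)$, and $E_{\tau,f}(\mu):=U_f(Q_f(\mu P^\tau))$. Define the retention error \[\varepsilon_{\tau,f}:=\max_{x\in X}\|Q_f(u_xP^\tau)-\delta_x\|_{\mathrm{TV}}.\] Then: (1) for all $x\in X$, $s_{\tau,f}(x):=\|E_{\tau,f}(u_x)-u_x\|_{\mathrm{TV}}\le \varepsilon_{\tau,f}$; (2) the idempotence defect $\delta_{\tau,f}:=\sup_{\mu\in\Delta(Z)}\|E_{\tau,f}(E_{\tau,f}(\mu))-E_{\tau,f}(\mu)\|_{\mathrm{TV}}$ satisfies $\delta_{\tau,f}\le\varepsilon_{\tau,f}$. In particular, if $\varepsilon_{\tau,f}=0$ then $E_{\tau,f}$ is exactly idempotent ($E_{\tau,f}\circ E_{\tau,f}=E_{\tau,f}$).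
   Context: $\Delta(Z)$ denotes the probability simplex on $Z$; distributions are row vectors and $\mu\mapsto\mu P$ is the one-step update. $\delta_x$ is the point mass at $x$. Total variation is $\|\mu-\nu\|_{\mathrm{TV}}=\tfrac12\|\mu-\nu\|_1$. *)

(* Defs.v *)
From HB Require Import structures.
From mathcomp Require Import all_boot all_order all_algebra.
From mathcomp Require Import boolp classical_sets reals.

Set Implicit Arguments.
Unset Strict Implicit.
Unset Printing Implicit Defensive.
Import Order.TTheory GRing.Theory Num.Theory.
Local Open Scope ring_scope.

Definition is_pmf (R : realType) (T : finType) (p : {ffun T -> R}) : bool :=
  [forall t, 0 <= p t] && (\sum_t p t == 1).

Record dist (R : realType) (T : finType) :=
  Dist { pmf :> {ffun T -> R}; pmfP : is_pmf pmf }.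

HB.instance Definition _ (R : realType) (T : finType) :=
  [isSub for @pmf R T].

Lemma dist_ge0 (R : realType) (T : finType) (mu : dist R T) t : 0 <= mu t.
Proof. by case/andP: (pmfP mu) => /forallP. Qed.

Lemma dist_sum1 (R : realType) (T : finType) (mu : dist R T) :
  \sum_t mu t = 1.
Proof. by case/andP: (pmfP mu) => _ /eqP. Qed.

Lemma is_pmf_dirac (R : realType) (T : finType) (x : T) :
  is_pmf [ffun y => (y == x)%:R : R].
Proof.
apply/andP; split; first by apply/forallP => y; rewrite ffunE ler0n.
rewrite (bigD1 x) //= ffunE eqxx big1 ?addr0 // => y /negPf yx.
by rewrite ffunE yx.
Qed.

Definition dirac (R : realType) (T : finType) (x : T) : dist R T :=
  Dist (is_pmf_dirac R x).

Lemma is_pmf_mix (R : realType) (S T : finType) (mu : dist R S)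
    (K : S -> dist R T) :
  is_pmf [ffun t => \sum_s mu s * K s t].
Proof.
apply/andP; split.
  by apply/forallP => t; rewrite ffunE sumr_ge0 // => s _;
     rewrite mulr_ge0 ?dist_ge0.
under eq_bigr do rewrite ffunE.
rewrite exchange_big /= -(dist_sum1 mu); apply/eqP/eq_bigr => s _.
by rewrite -mulr_sumr dist_sum1 mulr1.
Qed.

(* The product of the row vector mu with the row-stochastic matrix K, whose
   s-th row is K s: (mu K)(t) = \sum_s mu(s) K(s, t). *)
Definition act (R : realType) (S T : finType) (mu : dist R S)
    (K : S -> dist R T) : dist R T :=
  Dist (is_pmf_mix mu K).

Fixpoint kpow (R : realType) (T : finType) (K : T -> dist R T) (n : nat) :
    T -> dist R T :=
  if n is m.+1 then fun z => act (kpow K m z) K else @dirac R T.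

Definition fiber (Z X : finType) (f : Z -> X) (x : X) : {set Z} :=
  f @^-1: [set x].

Lemma is_pmf_Qf (R : realType) (Z X : finType) (f : Z -> X) (mu : dist R Z) :
  is_pmf [ffun x => \sum_(z in fiber f x) mu z].
Proof.
apply/andP; split.
  by apply/forallP => x; rewrite ffunE sumr_ge0 // => z _; apply: dist_ge0.
rewrite -(dist_sum1 mu) (partition_big f xpredT) //=; apply/eqP.
by apply: eq_bigr => x _; rewrite ffunE; apply: eq_bigl => z; rewrite !inE.
Qed.

Definition Qf (R : realType) (Z X : finType) (f : Z -> X) (mu : dist R Z) :
    dist R X :=
  Dist (is_pmf_Qf f mu).

Definition Uf (R : realType) (Z X : finType) (u : X -> dist R Z)
    (nu : dist R X) : dist R Z :=
  act nu u.

Definition Emap (R : realType) (Z X : finType) (P : Z -> dist R Z)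
    (f : Z -> X) (tau : nat) (u : X -> dist R Z) (mu : dist R Z) : dist R Z :=
  Uf u (Qf f (act mu (kpow P tau))).

Definition TV (R : realType) (T : finType) (mu nu : dist R T) : R :=
  2^-1 * \sum_t `|mu t - nu t|.

(* As TV is nonnegative, the initial value 0 only matters when X is empty. *)
Definition retention_error (R : realType) (Z X : finType) (P : Z -> dist R Z)
    (f : Z -> X) (tau : nat) (u : X -> dist R Z) : R :=
  \big[Num.max/0]_(x : X) TV (Qf f (act (u x) (kpow P tau))) (dirac R x).

Definition stability_defect (R : realType) (Z X : finType)
    (P : Z -> dist R Z) (f : Z -> X) (tau : nat) (u : X -> dist R Z) (x : X) :
    R :=
  TV (Emap P f tau u (u x)) (u x).

Definition idempotence_defect (R : realType) (Z X : finType)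
    (P : Z -> dist R Z) (f : Z -> X) (tau : nat) (u : X -> dist R Z) : R :=
  let E := Emap P f tau u in
  sup (range (fun mu : dist R Z => TV (E (E mu)) (E mu)))%classic.

Lemma TV_le1 (R : realType) (T : finType) (mu nu : dist R T) : TV mu nu <= 1.
Proof.
rewrite /TV ler_pdivrMl ?ltr0n // mulr1.
have -> : 2 = \sum_t (mu t + nu t) :> R.
  by rewrite big_split /= !dist_sum1.
apply: ler_sum => t _; apply: le_trans (ler_normB _ _) _.
by rewrite !ger0_norm ?dist_ge0.
Qed.

(* The supremum in idempotence_defect is a genuine one as soon as Z is
   nonempty. *)
Lemma idempotence_defect_has_sup (R : realType) (Z X : finType)
    (P : Z -> dist R Z) (f : Z -> X) (tau : nat) (u : X -> dist R Z) (z : Z) :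
  let E := Emap P f tau u in
  has_sup (range (fun mu : dist R Z => TV (E (E mu)) (E mu)))%classic.
Proof.
move=> E; split; first by exists (TV (E (E (dirac R z))) (E (dirac R z))),
  (dirac R z).
by exists 1 => _ [mu _ <-]; apply: TV_le1.
Qed.

(* Main.v *)
(* Coarse-graining and lifting are actions of stochastic kernels, so
   E(mu) = mu K for a kernel K that factors through X.  Total variation is
   nonincreasing under kernels, and u_x = delta_x U_f while
   E(u_x) = Q_f(u_x P^tau) U_f; this gives (1).  Every E(mu) is a mixture
   nu U_f of the u_x, so E(E(mu)) - E(mu) is the nu-average of the
   E(u_x) - u_x, and convexity of total variation reduces (2) to (1). *)
Require Import Defs.
From HB Require Import structures.
From mathcomp Require Import all_boot all_order all_algebra.
From mathcomp Require Import boolp classical_sets reals.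
Import Order.TTheory GRing.Theory Num.Theory.
Local Open Scope ring_scope.

Lemma dist_ext (R : realType) (T : finType) (mu nu : dist R T) :
  mu =1 nu -> mu = nu.
Proof. by move=> eq_mn; apply/val_inj/ffunP. Qed.

Lemma act_diracl (R : realType) (S T : finType) (x : S) (K : S -> dist R T) :
  act (dirac R x) K = K x.
Proof.
apply: dist_ext => t; rewrite ffunE (bigD1 x) //= ffunE eqxx mul1r.
by rewrite big1 ?addr0 // => s /negPf sx; rewrite ffunE sx mul0r.
Qed.

Lemma actA (R : realType) (S T V : finType) (mu : dist R S)
    (K : S -> dist R T) (L : T -> dist R V) :
  act (act mu K) L = act mu (fun s => act (K s) L).
Proof.
apply: dist_ext => v; rewrite !ffunE.
under eq_bigr do rewrite ffunE mulr_suml.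
rewrite exchange_big /=; apply: eq_bigr => s _.
by rewrite ffunE mulr_sumr; apply: eq_bigr => t _; rewrite mulrA.
Qed.

(** The kernel is deterministic: it sends [z] to the point mass at [f z]. In this form [actA]
    applies to coarse-graining. *)
Lemma Qf_act_dirac (R : realType) (Z X : finType) (f : Z -> X)
    (mu : dist R Z) :
  Qf f mu = act mu (fun z => dirac R (f z)).
Proof.
apply: dist_ext => x; rewrite !ffunE big_mkcond /=.
apply: eq_bigr => z _; rewrite ffunE !inE eq_sym.
by case: eqP => _; rewrite ?mulr1 ?mulr0.
Qed.

(** Each stage of [Emap] is a kernel action, so associativity carries it inside a mixture; taking
    [K := u] handles mixtures of the [u x]. *)
Lemma Emap_act (R : realType) (Z X : finType) (P : Z -> dist R Z)
    (f : Z -> X) (tau : nat) (u : X -> dist R Z) (S : finType)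
    (nu : dist R S) (K : S -> dist R Z) :
  Emap P f tau u (act nu K) = act nu (fun s => Emap P f tau u (K s)).
Proof.
rewrite /Emap /Uf Qf_act_dirac !actA; congr act; apply/funext => s.
by rewrite Qf_act_dirac !actA.
Qed.

Lemma TV_ge0 (R : realType) (T : finType) (mu nu : dist R T) : 0 <= TV mu nu.
Proof. by rewrite mulr_ge0 ?invr_ge0 ?ler0n ?sumr_ge0. Qed.

Lemma TV_eq0 (R : realType) (T : finType) (mu nu : dist R T) :
  TV mu nu = 0 -> mu = nu.
Proof.
move/eqP; rewrite mulf_eq0 invr_eq0 pnatr_eq0 /= psumr_eq0 // => /allP eq0.
apply: dist_ext => t; apply/eqP; rewrite -subr_eq0 -normr_eq0.
by apply: eq0; rewrite mem_index_enum.
Qed.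

Lemma TV_actl (R : realType) (S T : finType) (mu nu : dist R S)
    (K : S -> dist R T) :
  TV (act mu K) (act nu K) <= TV mu nu.
Proof.
rewrite /TV ler_wpM2l ?invr_ge0 ?ler0n //.
(* Triangle inequality for each [t]; summing over [t] first then removes [K], whose rows sum to
   1. *)
apply: (@le_trans _ _ (\sum_t \sum_s `|mu s - nu s| * K s t)).
  apply: ler_sum => t _; rewrite !ffunE -sumrB.
  apply: le_trans (ler_norm_sum _ _ _) _; apply: ler_sum => s _.
  by rewrite -mulrBl normrM (ger0_norm (dist_ge0 _ _)).
rewrite exchange_big /=; apply: ler_sum => s _.
by rewrite -mulr_sumr dist_sum1 mulr1.
Qed.

(** Both mixtures carry the same nonnegative weights, so the triangle inequality works termwise in
    [s]. *)
Lemma TV_actr (R : realType) (S T : finType) (mu : dist R S)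
    (K L : S -> dist R T) :
  TV (act mu K) (act mu L) <= \sum_s mu s * TV (K s) (L s).
Proof.
rewrite /TV; under [leRHS]eq_bigr do rewrite mulrCA.
rewrite -mulr_sumr ler_wpM2l ?invr_ge0 ?ler0n //.
under [leRHS]eq_bigr do rewrite mulr_sumr.
rewrite exchange_big /=; apply: ler_sum => t _; rewrite !ffunE -sumrB.
apply: le_trans (ler_norm_sum _ _ _) _; apply: ler_sum => s _.
by rewrite -mulrBr normrM (ger0_norm (dist_ge0 _ _)).
Qed.

Lemma TV_act_le (R : realType) (S T : finType) (mu : dist R S)
    (K L : S -> dist R T) (e : R) :
  (forall s, TV (K s) (L s) <= e) -> TV (act mu K) (act mu L) <= e.
Proof.
move=> le_e; apply: le_trans (TV_actr _ _ _ _ _ _) _.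
rewrite -[e]mul1r -(dist_sum1 mu) mulr_suml; apply: ler_sum => s _.
by rewrite ler_wpM2l ?dist_ge0.
Qed.

(** This settles the case of empty [Z], where the supremum takes its default value 0. *)
Lemma retention_error_ge0 (R : realType) (Z X : finType) (P : Z -> dist R Z)
    (f : Z -> X) (tau : nat) (u : X -> dist R Z) :
  0 <= retention_error P f tau u.
Proof.
by apply: (big_ind (fun r : R => 0 <= r)) => [//|r s r0 _|x _];
  rewrite ?le_max ?r0 ?TV_ge0.
Qed.

Lemma stability_defect_le (R : realType) (Z X : finType) (P : Z -> dist R Z)
    (f : Z -> X) (tau : nat) (u : X -> dist R Z) (x : X) :
  stability_defect P f tau u x <= retention_error P f tau u.
Proof.
(* Both arguments become images under the kernel [u], which contraction cancels. *)
rewrite /stability_defect -[X in TV _ X](act_diracl R X Z x u).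
apply: le_trans (TV_actl _ _ _ _ _ _) _.
by rewrite /retention_error (bigD1 x) //= le_max lexx.
Qed.

Lemma TV_Emap_idem_le (R : realType) (Z X : finType) (P : Z -> dist R Z)
    (f : Z -> X) (tau : nat) (u : X -> dist R Z) (mu : dist R Z) :
  TV (Emap P f tau u (Emap P f tau u mu)) (Emap P f tau u mu)
    <= retention_error P f tau u.
Proof.
(* With [nu := Qf f (act mu (kpow P tau))], the two sides are the [nu]-mixtures of
   [Emap P f tau u (u x)] and of [u x]. *)
rewrite [Emap P f tau u mu]/Emap /Uf Emap_act.
exact/TV_act_le/stability_defect_le.
Qed.

Theorem mainTheorem1 (R : realType) (Z X : finType) (P : Z -> dist R Z)
    (f : Z -> X) (tau : nat) (u : X -> dist R Z)
    (tau_ge1 : (1 <= tau)%N)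
    (supp_u : forall x : X, support (u x) \subset fiber f x) :
  [/\ forall x : X,
        stability_defect P f tau u x <= retention_error P f tau u,
      idempotence_defect P f tau u <= retention_error P f tau u
    & retention_error P f tau u = 0 ->
        Emap P f tau u \o Emap P f tau u =1 Emap P f tau u].
Proof.
split=> [x||eps0 mu]; first exact: stability_defect_le.
- rewrite /idempotence_defect /=; set A := (A in sup A).
  (* With no distribution on Z the range is empty and its sup is 0. *)
  have [->|A0] := eqVneq A set0; first by rewrite sup0 retention_error_ge0.
  apply: ge_sup; first exact/set0P.
  by move=> _ [mu _ <-]; apply: TV_Emap_idem_le.
- apply/TV_eq0/le_anti; rewrite TV_ge0 andbT -eps0.
  exact: TV_Emap_idem_le.
Qed.
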